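(* Let $d\geq 2$ and $\mathbf{k}=(k_1,\dots,k_{d+1})\in\mathbb{N}^{d+1}$ be positive integers, not all equal. Then there is a subgroup $H$ of $C_{d+1}$, of cardinality $\ell$, whose elements induce automorphisms of $T_{\mathbf{k}}$, such that the automorphism group of $T_{\mathbf{k}}$ is generated by (the automorphisms induced by) $T$, $R$ and $H$, and has cardinality $2\ell\det M_{\mathbf{k}}$.
   Context: Let $e_1,\dots,e_{d+1}$ be the standard basis of $\mathbb{R}^{d+1}$, $\widetilde w_i=e_i-\frac1{d+1}\sum_je_j$. $M_{\mathbf{k}}$ is the $(d+1)\times(d+1)$ integer matrix whose $i$-th row has entry $k_i+1$ in column $i$, entry $-k_{i+1}$ in column $i+1$ (indices cyclic mod $d+1$), zeros elsewhere; $\widetilde L_{\mathbf{k}}=\{\sum a_i\widetilde w_i: a=bM_{\mathbf{k}},\ b\in\mathbb{Z}^{d+1}\}$. $V=\{\mathbf{x}:\sum x_i=0\}$; $\Sigma_d$ is the simplicial complex on $V$ cut out by the affine hyperplanes $x_j-x_i=m$ ($i<j$, $m\in\mathbb{Z}$), with vertex set $\widetilde\Lambda_d=\mathbb{Z}$-span of the $\widetilde w_i$. $T_{\mathbf{k}}$ is the complex of classes of faces of $\Sigma_d$ under translation by $\widetilde L_{\mathbf{k}}$. $T$ is the group of automorphisms of $T_{\mathbf{k}}$ induced by translations by vectors of $\widetilde\Lambda_d$; $R$ is induced by $\mathbf{x}\mapsto-\mathbf{x}$; $C_{d+1}$ is the cyclic group of linear maps of $V$ generated by the cyclic coordinate shift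 sending $\widetilde w_i$ to $\widetilde w_{i+1}$ (indices mod $d+1$). *)

(* Defs.v *)
From HB Require Import structures.
From mathcomp Require Import all_boot all_order all_algebra.
From mathcomp Require Import all_classical all_reals.

Set Implicit Arguments.
Unset Strict Implicit.
Unset Printing Implicit Defensive.

Import Order.TTheory GRing.Theory Num.Theory.
Local Open Scope classical_set_scope.
Local Open Scope ring_scope.

(* Indices 1, ..., d+1 are represented by 'I_d.+1; [ordS] and [ord_pred] are
   the cyclic successor and predecessor on it. *)

Definition is_transf_group (X : Type) (G : set (X -> X)) : Prop :=
  [/\ G id,
      forall f g, G f -> G g -> G (f \o g) &
      forall f, G f -> exists g, [/\ G g, cancel f g & cancel g f]].

Definition generated (X : Type) (S : set (X -> X)) : set (X -> X) :=
  smallest (@is_transf_group X) S.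

(* Automorphisms of the simplicial complex with vertex set X whose simplices,
   given as sets of vertices, are the members of F. *)
Definition simplicial_aut (X : Type) (F : set (set X)) : set (X -> X) :=
  [set f | bijective f /\ forall S : set X, F (f @` S) <-> F S].

Definition sum_coord (R : realType) (d : nat) (x : 'rV[R]_d.+1) : R :=
  \sum_i x 0 i.

Definition zero_sum (R : realType) (d : nat) : {pred 'rV[R]_d.+1} :=
  [pred x | sum_coord x == 0].

Lemma zero_sum_submod (R : realType) (d : nat) : submod_closed (@zero_sum R d).
Proof.
split=> [|a x y]; rewrite !inE /sum_coord.
  by rewrite big1 // => i _; rewrite mxE.
move=> /eqP x0 /eqP y0.
under eq_bigr do rewrite !mxE.
by rewrite big_split /= -mulr_sumr x0 y0 mulr0 addr0.
Qed.

HB.instance Definition _ (R : realType) (d : nat) :=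
  GRing.isSubmodClosed.Build R 'rV[R]_d.+1 (@zero_sum R d)
    (@zero_sum_submod R d).

Record V (R : realType) (d : nat) : Type :=
  MkV { Vval :> 'rV[R]_d.+1; _ : Vval \in @zero_sum R d }.

HB.instance Definition _ (R : realType) (d : nat) := [isSub for @Vval R d].
HB.instance Definition _ (R : realType) (d : nat) := [Choice of V R d by <:].
HB.instance Definition _ (R : realType) (d : nat) :=
  [SubChoice_isSubZmodule of V R d by <:].
HB.instance Definition _ (R : realType) (d : nat) :=
  [SubZmodule_isSubLmodule of V R d by <:].

Definition coord (R : realType) (d : nat) (x : V R d) (i : 'I_d.+1) : R :=
  Vval x 0 i.

Definition wt_row (R : realType) (d : nat) (i : 'I_d.+1) : 'rV[R]_d.+1 :=
  delta_mx 0 i - (d.+1%:R)^-1 *: \sum_j delta_mx 0 j.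

Lemma wt_row_zero_sum (R : realType) (d : nat) (i : 'I_d.+1) :
  wt_row R i \in @zero_sum R d.
Proof.
have sE (j : 'I_d.+1) : sum_coord (delta_mx 0 j : 'rV[R]_d.+1) = 1.
  rewrite /sum_coord (bigD1 j) //= mxE !eqxx big1 ?addr0 // => l lj.
  by rewrite mxE (negbTE lj) andbF.
have -> : wt_row R i \in @zero_sum R d = (sum_coord (wt_row R i) == 0) by [].
have -> : sum_coord (wt_row R i) = sum_coord (delta_mx 0 i : 'rV[R]_d.+1) -
    (d.+1%:R)^-1 * \sum_j sum_coord (delta_mx 0 j : 'rV[R]_d.+1).
  rewrite /sum_coord exchange_big mulr_sumr -sumrB.
  by apply: eq_bigr => l _; rewrite !mxE summxE.
rewrite sE (eq_bigr (fun=> 1)) => [|j _]; last exact: sE.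
by rewrite sumr_const card_ord mulVf ?pnatr_eq0 // subrr.
Qed.

Definition wt (R : realType) (d : nat) (i : 'I_d.+1) : V R d :=
  MkV (wt_row_zero_sum R i).

Definition Lambda (R : realType) (d : nat) : set (V R d) :=
  [set x | exists a : 'rV[int]_d.+1, x = \sum_i wt R i *~ a 0 i].
Arguments Lambda : clear implicits.

Definition shift_row (R : realType) (d : nat) (x : 'rV[R]_d.+1)
    : 'rV[R]_d.+1 :=
  \row_j x 0 (ord_pred j).

Lemma shift_row_zero_sum (R : realType) (d : nat) (x : V R d) :
  shift_row (Vval x) \in @zero_sum R d.
Proof.
case: x => x /= /eqP x0; rewrite inE -x0 /sum_coord; apply/eqP.
rewrite [RHS](reindex (@ord_pred d.+1)) /=.
  by apply: eq_bigr => i _; rewrite mxE.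
by apply: onW_bij; apply: ord_pred_bij.
Qed.

Definition shift (R : realType) (d : nat) (x : V R d) : V R d :=
  MkV (shift_row_zero_sum x).

Lemma shift_is_linear (R : realType) (d : nat) : linear (@shift R d).
Proof. by move=> a x y; apply: val_inj; apply/rowP => j; rewrite !mxE. Qed.

Lemma shift_wt (R : realType) (d : nat) (i : 'I_d.+1) :
  shift (wt R i) = wt R (ordS i).
Proof.
apply: val_inj; apply/rowP => j; rewrite !mxE !summxE.
have sE (l : 'I_d.+1) : \sum_m (delta_mx 0 m : 'rV[R]_d.+1) 0 l = 1.
  rewrite (bigD1 l) //= mxE !eqxx big1 ?addr0 // => m ml.
  by rewrite mxE eq_sym (negbTE ml) andbF.
by rewrite !sE -(inj_eq (@ordS_inj _) (ord_pred j)) ord_predK.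
Qed.

Definition Ccyc (R : realType) (d : nat) : set (V R d -> V R d) :=
  generated [set @shift R d].
Arguments Ccyc : clear implicits.

Definition M (d : nat) (k : 'I_d.+1 -> nat) : 'M[int]_d.+1 :=
  \matrix_(i, j) (if j == i then (k i).+1%:Z
                  else if j == ordS i then - (k (ordS i))%:Z
                  else 0).

Definition L (R : realType) (d : nat) (k : 'I_d.+1 -> nat) : set (V R d) :=
  [set x | exists b : 'rV[int]_d.+1, x = \sum_i wt R i *~ (b *m M k) 0 i].

(* [closed_cell x] is the smallest closed cell of the
   arrangement of the hyperplanes x_j - x_i = m that contains x: the
   intersection of all closed half-spaces bounded by these hyperplanes that
   contain x. A face of Sigma_d is recorded through its set of vertices. *)

Definition closed_cell (R : realType) (d : nat) (x : V R d) : set (V R d) :=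
  [set y | forall (i j : 'I_d.+1) (m : int), (i < j)%N ->
     (coord x j - coord x i <= m%:~R -> coord y j - coord y i <= m%:~R) /\
     (m%:~R <= coord x j - coord x i -> m%:~R <= coord y j - coord y i)].

Definition Sigma_face (R : realType) (d : nat) : set (set (V R d)) :=
  [set s | exists x, s = closed_cell x `&` Lambda R d].
Arguments Sigma_face : clear implicits.

(* The vertices of T_k are the L-classes of vertices of Sigma_d. The class of a
   face is recorded as the set of the classes of its vertices: when all k_i are
   positive, faces with the same vertex classes differ by a vector of L. *)

Definition class_of (R : realType) (d : nat) (k : 'I_d.+1 -> nat) (x : V R d)
    : set (V R d) :=
  [set y | L k (y - x)].

Definition Tvertex (R : realType) (d : nat) (k : 'I_d.+1 -> nat) : Type :=
  set_type (class_of k @` Lambda R d).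

Definition Tface (R : realType) (d : nat) (k : 'I_d.+1 -> nat)
    : set (set (Tvertex R k)) :=
  [set S | exists2 s, Sigma_face R d s &
     S = [set u | exists2 v, s v & val u = class_of k v]].
Arguments Tface R {d} k _ : rename.

Definition AutT (R : realType) (d : nat) (k : 'I_d.+1 -> nat)
    : set (Tvertex R k -> Tvertex R k) :=
  simplicial_aut (Tface R k).
Arguments AutT R {d} k _ : rename.

Definition induces (R : realType) (d : nat) (k : 'I_d.+1 -> nat)
    (phi : V R d -> V R d) (f : Tvertex R k -> Tvertex R k) : Prop :=
  forall (u : Tvertex R k) (v : V R d), val u v -> val (f u) (phi v).

Definition induced_auts (R : realType) (d : nat) (k : 'I_d.+1 -> nat)
    (G : set (V R d -> V R d)) : set (Tvertex R k -> Tvertex R k) :=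
  [set f | AutT R k f /\ exists2 phi, G phi & induces phi f].

Definition translations (R : realType) (d : nat) : set (V R d -> V R d) :=
  [set phi | exists2 t, Lambda R d t & phi = (fun x => x + t)].
Arguments translations : clear implicits.

Definition Tgroup (R : realType) (d : nat) (k : 'I_d.+1 -> nat)
    : set (Tvertex R k -> Tvertex R k) :=
  induced_auts (translations R d).
Arguments Tgroup R {d} k _ : rename.

Definition Rgroup (R : realType) (d : nat) (k : 'I_d.+1 -> nat)
    : set (Tvertex R k -> Tvertex R k) :=
  induced_auts [set (fun x : V R d => - x)].
Arguments Rgroup R {d} k _ : rename.

(* Main.v *)
(* The row lattice of M contains (1,...,1), so the vertices of T_k are the
   classes of Z^(d+1) modulo that lattice. The entries of b M are
   b_j + k_j (b_j - b_(j-1)); looking at the extremal entries of b, one sees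
   that the indicators of the proper subsets of {1,...,d+1} are in distinct
   classes. Hence the link of a vertex is the complex of chains of nonempty
   proper subsets, whose automorphisms are the permutations of the indices and
   their compositions with complementation. The permutations and signs at
   adjacent vertices agree, so an automorphism of T_k is a |-> t +- s(a) with s
   a permutation of the coordinates preserving the row lattice. Estimating the
   vectors of the lattice with two nonzero entries of opposite signs shows that
   s is a cyclic rotation. Counting t, the sign and s gives 2 l det M. *)
Require Import Defs.
From mathcomp Require Import all_boot all_order all_algebra.
From mathcomp Require Import perm zify.

Set Implicit Arguments.
Unset Strict Implicit.
Unset Printing Implicit Defensive.

Import Order.TTheory GRing.Theory Num.Theory.
Local Open Scope ring_scope.

(** * Induction around the cycle of indices *)

Lemma iter_ordS n m (i : 'I_n) : iter m (@ordS n) i = ((i + m) %% n)%N :> nat.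
Proof.
elim: m => [|m IH] /=; first by rewrite addn0 modn_small.
by rewrite IH -addn1 modnDml -addnA addn1.
Qed.

Lemma ordS_ind n (P : 'I_n -> Prop) (i0 : 'I_n) :
  P i0 -> (forall i, P i -> P (ordS i)) -> forall i, P i.
Proof.
move=> P0 PS i.
(* Since i0 + (i + (n - i0)) = i + n, this many successor steps lead from i0 to i. *)
have -> : i = iter (i + (n - i0))%N (@ordS n) i0.
  apply: val_inj; rewrite [RHS]/= iter_ordS addnCA subnKC ?(ltnW (ltn_ord _)) //.
  by rewrite modnDr modn_small.
by elim: (_ + _)%N => [//|m IH] /=; apply: PS.
Qed.

Lemma ord_pred_ind n (P : 'I_n -> Prop) (i0 : 'I_n) :
  P i0 -> (forall i, P i -> P (ord_pred i)) -> forall i, P i.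
Proof.
move=> P0 Pp i.
(* Backward induction from i0 is forward induction from i on the implication from j to i, which is
   trivial at j = i. *)
pose Q j := P j -> P i.
suff: Q i0 by apply.
apply: (@ordS_ind _ Q i) => // j Qj Pj; apply: Qj.
by rewrite -(ordSK j); apply: Pp.
Qed.

Lemma ordS_neq d (i : 'I_d.+1) : (0 < d)%N -> ordS i != i.
Proof.
move=> d0; apply/eqP => /(congr1 val) /=.
have := ltn_ord i; rewrite leq_eqVlt => /predU1P[[->]|id]; last first.
  by rewrite modn_small ?ltnS //; lia.
by rewrite modnn; lia.
Qed.

Lemma ordSS_neq d (i : 'I_d.+1) : (1 < d)%N -> ordS (ordS i) != i.
Proof.
move=> d1; apply/eqP => /(congr1 val).
have -> : val (ordS (ordS i)) = ((i + 2) %% d.+1)%N := iter_ordS 2 i.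
have [id|id] := ltnP (i + 2) d.+1; first by rewrite modn_small //=; lia.
have -> : (i + 2 = (i + 2 - d.+1) + d.+1)%N by lia.
rewrite modnDr modn_small; have := ltn_ord i; simpl; lia.
Qed.

(** * The row lattice *)

Section Lattice.
Variables (d : nat) (k : 'I_d.+1 -> nat).
Hypotheses (hd : (2 <= d)%N) (kpos : forall i, (0 < k i)%N).
Implicit Types (a b : 'rV[int]_d.+1) (S T : {set 'I_d.+1}).

Definition rowlat a := exists b, a = b *m M k.

Lemma mulM_coord b j :
  (b *m M k) 0 j = b 0 j + (k j)%:Z * (b 0 j - b 0 (ord_pred j)).
Proof.
have pj : ord_pred j != j.
  by rewrite -{2}(ord_predK j) eq_sym ordS_neq // ltnW.
rewrite mxE (bigD1 j) //= (bigD1 (ord_pred j)) //= big1 => [|i /andP[ij ipj]].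
  rewrite !mxE eqxx ord_predK eqxx eq_sym (negbTE pj) addr0; lia.
rewrite !mxE eq_sym (negbTE ij) ifN ?mulr0 //.
by apply: contra ipj => /eqP ->; rewrite ordSK.
Qed.

Lemma rowlat0 : rowlat 0. Proof. by exists 0; rewrite mul0mx. Qed.
Lemma rowlatD a b : rowlat a -> rowlat b -> rowlat (a + b).
Proof. by move=> [x ->] [y ->]; exists (x + y); rewrite mulmxDl. Qed.
Lemma rowlatN a : rowlat a -> rowlat (- a).
Proof. by move=> [x ->]; exists (- x); rewrite mulNmx. Qed.

(** Each column of [M k] sums to k_j + 1 - k_j = 1. *)
Lemma const_mulM (c : int) : (const_mx c : 'rV_d.+1) *m M k = const_mx c.
Proof. by apply/rowP => j; rewrite mulM_coord !mxE subrr mulr0 addr0. Qed.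

Lemma rowlat_const c : rowlat (const_mx c).
Proof. by exists (const_mx c); rewrite const_mulM. Qed.

Lemma exists_max b : exists j, forall i, b 0 i <= b 0 j.
Proof.
by case: (@arg_maxP _ _ _ ord0 xpredT (b 0)) => // j _ h; exists j => i; apply: h.
Qed.

(** Where b attains a maximum at least 1, the bound b_i + k_i (b_i - b_(i-1)) <= 1 forces b_i = 1
    and b_(i-1) = b_i. Walking backwards around the cycle makes b constant. *)
Lemma mulM_le1 b : (forall j, (b *m M k) 0 j <= 1) ->
  (forall j, b 0 j <= 0) \/ b = const_mx 1.
Proof.
move=> h; have [j bj] := exists_max b.
have step i : b 0 i = b 0 j -> 1 <= b 0 j -> b 0 i = 1 /\ b 0 (ord_pred i) = b 0 j.
  move=> ij b1; have := h i; rewrite mulM_coord ij.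
  have := bj (ord_pred i); have := kpos i => *; split; nia.
have [b0|b1] := lerP (b 0 j) 0; [left=> i | right].
  exact: le_trans (bj i) b0.
have E i : b 0 i = b 0 j.
  by apply: (@ord_pred_ind _ (fun i => b 0 i = b 0 j) j) => // l lj; case: (step l).
by apply/rowP => i; rewrite mxE; case: (step i).
Qed.

Definition ind S : 'rV[int]_d.+1 := \row_j (j \in S)%:R.

(** By [mulM_le1] applied to b and to -b, both are nonpositive, so b = 0: the alternative b = 1
    would make an indicator difference equal to 1 everywhere, hence S or T full. *)
Lemma rowlat_ind_inj S T : S != setT -> T != setT -> rowlat (ind S - ind T) -> S = T.
Proof.
move=> ST TT [b bE].
have aux (A B : {set 'I_d.+1}) c : A != setT -> ind A - ind B = c *m M k ->
    forall j, c 0 j <= 0.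
  move=> AT cE; case: (@mulM_le1 c) => [j|//|c1].
    by rewrite -cE !mxE; case: (_ \in A) (_ \in B) => [] [].
  case/eqP: AT; apply/setP => j; rewrite inE.
  have := congr1 (fun x : 'rV_d.+1 => x 0 j) cE.
  by rewrite c1 const_mulM !mxE; case: (_ \in A) (_ \in B) => [] [].
have b0 : b = 0.
  apply/rowP => j; apply/eqP; rewrite mxE eq_le (aux _ _ _ ST bE) /=.
  have /(_ j) : forall j, (- b) 0 j <= 0.
    by apply: (aux T S _ TT); rewrite mulNmx -bE opprB.
  by rewrite mxE oppr_le0.
move: bE; rewrite b0 mul0mx => /eqP; rewrite subr_eq0 => /eqP E.
apply/setP => j; have := congr1 (fun x : 'rV_d.+1 => x 0 j) E.
by rewrite !mxE; case: (_ \in S) (_ \in T) => [] [].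
Qed.

(* A positive entry of b forces b to attain its maximum at p only, and a
   negative entry forces it to attain its minimum at q only. *)
Lemma rowlat_two_terms b p q (al be : int) : p != q -> 0 < al -> 0 < be ->
  b *m M k = al *: delta_mx 0 p - be *: delta_mx 0 q ->
  (k p + k q)%:Z + 1 <= al + be /\
  (al + be = (k p + k q)%:Z + 1 ->
   q = ordS p \/ [/\ p = ordS q, al <= (k p)%:Z & (k q)%:Z < be]).
Proof.
move=> pq al0 be0 bE.
have E j : b 0 j + (k j)%:Z * (b 0 j - b 0 (ord_pred j)) =
    al *+ (j == p) - be *+ (j == q).
  by rewrite -mulM_coord bE !mxE /= !mulr_natr.
have Ep : b 0 p + (k p)%:Z * (b 0 p - b 0 (ord_pred p)) = al.
  by rewrite E eqxx (negbTE pq) subr0.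
have Eq : b 0 q + (k q)%:Z * (b 0 q - b 0 (ord_pred q)) = - be.
  by rewrite E eqxx eq_sym (negbTE pq) sub0r.
have maxp j : 0 < b 0 j -> forall i, i != p -> b 0 i < b 0 p.
  move=> bj i ip.
  have [l bl] := exists_max b.
  have l0 : 0 < b 0 l := lt_le_trans bj (bl j).
  have pos m : b 0 m = b 0 l -> m = p.
    move=> ml; apply/eqP; apply: contraT => mp.
    have := E m; rewrite (negbTE mp) ml => Em.
    have := bl (ord_pred m); have := kpos m.
    by case: (m == q) Em; nia.
  have lp := pos _ erefl; rewrite lp in bl.
  rewrite lt_neqAle bl andbT; apply: contra ip => /eqP ip.
  by apply/eqP/pos; rewrite lp.
have minq j : b 0 j < 0 -> forall i, i != q -> b 0 q < b 0 i.
  move=> bj i iq.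
  have [l] := exists_max (- b).
  have -> : (forall i, (- b) 0 i <= (- b) 0 l) <-> (forall i, b 0 l <= b 0 i).
    by split=> h s; have := h s; rewrite !mxE lerN2.
  move=> bl; have l0 : b 0 l < 0 := le_lt_trans (bl j) bj.
  have pos m : b 0 m = b 0 l -> m = q.
    move=> ml; apply/eqP; apply: contraT => mq.
    have := E m; rewrite (negbTE mq) ml => Em.
    have := bl (ord_pred m); have := kpos m.
    by case: (m == p) Em; nia.
  have lq := pos _ erefl; rewrite lq in bl.
  rewrite lt_neqAle bl andbT; apply: contra iq => /eqP iq.
  by apply/eqP/pos; rewrite lq.
have pp (i : 'I_d.+1) : ord_pred i != i.
  by rewrite -{2}(ord_predK i) eq_sym ordS_neq // ltnW.
have kp := kpos p; have kq := kpos q.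
(* If b_p > 0 > b_q the inequality is strict. If only one of these two signs holds, equality forces
   p and q to be neighbours, with q after p in the second case and p after q in the third. The last
   case is contradictory: b_(p-1) < 0 would make q the only minimum, although b_q >= 0 >= b_p. *)
have [bp|bp] := ltrP 0 (b 0 p); have [bq|bq] := ltrP (b 0 q) 0.
- have := maxp _ bp _ (pp p); have := minq _ bq _ (pp q) => h1 h2.
  split; nia.
- have h := maxp _ bp _ (pp p).
  have s : b 0 q < b 0 (ord_pred q) by nia.
  have [Q|Q] := eqVneq (ord_pred q) p.
    rewrite Q in s Eq *; split; first nia.
    by left; rewrite -Q ord_predK.
  have := maxp _ bp _ Q; split; nia.
- have h := minq _ bq _ (pp q).
  have s : b 0 (ord_pred p) < b 0 p by nia.
  have [Q|Q] := eqVneq (ord_pred p) q.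
    rewrite Q in s Ep; split; first nia.
    by right; split; [rewrite -Q ord_predK | nia | nia].
  have := minq _ bq _ Q; split; nia.
- have : b 0 (ord_pred p) < 0 by nia.
  move=> /minq m; have [e|/m] := eqVneq p q; first by rewrite e eqxx in pq.
  nia.
Qed.

Definition pact (s : 'S_d.+1) a : 'rV[int]_d.+1 := \row_j a 0 ((s^-1)%g j).

Lemma pact_delta s i : pact s (delta_mx 0 i) = delta_mx 0 (s i).
Proof.
apply/rowP => j; rewrite !mxE !eqxx /=.
by rewrite -(inj_eq (@perm_inj _ s) ((s^-1)%g j)) permKV.
Qed.
Lemma pactD s a b : pact s (a + b) = pact s a + pact s b.
Proof. by apply/rowP => j; rewrite !mxE. Qed.
Lemma pactN s a : pact s (- a) = - pact s a.
Proof. by apply/rowP => j; rewrite !mxE. Qed.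
Lemma pactZ s c a : pact s (c *: a) = c *: pact s a.
Proof. by apply/rowP => j; rewrite !mxE. Qed.

Lemma row_M i : row i (M k) =
  (k i).+1%:Z *: delta_mx 0 i - (k (ordS i))%:Z *: delta_mx 0 (ordS i).
Proof.
have i' : ordS i != i by rewrite ordS_neq // ltnW.
apply/rowP => j; rewrite !mxE !eqxx /=.
have [->|ji] := eqVneq j i; first by rewrite eq_sym (negbTE i') mulr1 mulr0 subr0.
by rewrite mulr0 sub0r; case: eqP => _; rewrite ?mulr1 ?mulr0 ?oppr0.
Qed.

Lemma rowlat_row i : rowlat (row i (M k)).
Proof. by exists (delta_mx 0 i); rewrite rowE. Qed.

(* Applied to the image of each row of M, the inequality of [rowlat_two_terms]
   must be an equality, since both sides have the same sum over all rows. So s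
   maps neighbours to neighbours, and two consecutive descents contradict the
   last two inequalities of that lemma. *)
Lemma perm_rowlat_rot (s : 'S_d.+1) : (forall a, rowlat a -> rowlat (pact s a)) ->
  forall i, s (ordS i) = ordS (s i).
Proof.
move=> sL.
have two i : (k (s i) + k (s (ordS i)))%:Z + 1 <= (k i).+1%:Z + (k (ordS i))%:Z /\
  ((k i).+1%:Z + (k (ordS i))%:Z = (k (s i) + k (s (ordS i)))%:Z + 1 ->
   s (ordS i) = ordS (s i) \/
   [/\ s i = ordS (s (ordS i)), (k i).+1%:Z <= (k (s i))%:Z &
       (k (s (ordS i)))%:Z < (k (ordS i))%:Z]).
  have [b bE] := sL _ (rowlat_row i).
  apply: (@rowlat_two_terms b).
  - by rewrite (inj_eq (@perm_inj _ s)) eq_sym ordS_neq // ltnW.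
  - by [].
  - by rewrite ltz_nat.
  - by rewrite -bE row_M pactD pactN !pactZ !pact_delta.
have le i : (k (s i) + k (s (ordS i)) <= k i + k (ordS i))%N.
  by have [] := two i; lia.
have sumE : (\sum_i (k (s i) + k (s (ordS i))) = \sum_i (k i + k (ordS i)))%N.
  rewrite !big_split /=; congr addn.
    by rewrite [RHS](reindex_inj (@perm_inj _ s)).
  rewrite -[RHS](reindex (@ordS d.+1) (P := xpredT) (F := k)); last first.
    by apply: onW_bij; apply: ordS_bij.
  rewrite [RHS](reindex_inj (@perm_inj _ s)) /= [RHS](reindex (@ordS d.+1)) //.
  by apply: onW_bij; apply: ordS_bij.
have eq i : (k (s i) + k (s (ordS i)) = k i + k (ordS i))%N.
  apply/eqP; rewrite eqn_leq le /= leqNgt; apply/negP => lt.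
  have: (\sum_i (k (s i) + k (s (ordS i))) < \sum_i (k i + k (ordS i)))%N.
    rewrite (bigD1 i) //= [ltnRHS](bigD1 i) //= -addSn leq_add //.
    by apply: leq_sum => j _; apply: le.
  by rewrite sumE ltnn.
have down i : s (ordS i) = ordS (s i) \/
   [/\ s i = ordS (s (ordS i)), (k i < k (s i))%N & (k (s (ordS i)) < k (ordS i))%N].
  have [_ h] := two i; have := eq i => e.
  case: h => [|->|[-> h1 h2]]; [lia|by left|right; split=> //; lia].
(* After a descent at i, the bounds on k rule out a descent at i+1. An ascent there gives s (i+2) =
   s i, impossible because d >= 2. *)
move=> i; case: (down i) => // -[si _ ki].
case: (down (ordS i)) => [s2|[_ k2 _]]; last by rewrite ltnNge ltnW in k2.
by have := ordSS_neq i hd; rewrite -(inj_eq (@perm_inj _ s)) s2 -si eqxx.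
Qed.

End Lattice.

(** * Automorphisms of the nesting relation *)

Section Comparability.
Variable T : finType.
Hypothesis T3 : (2 < #|T|)%N.
Implicit Types (A B C : {set T}) (i j : T).

Definition nested A B := (A \subset B) || (B \subset A).

Lemma nestedC A B : nested A B = nested B A. Proof. by rewrite /nested orbC. Qed.

Lemma nested_setC A B : nested (~: A) (~: B) = nested A B.
Proof. by rewrite /nested !setCS orbC. Qed.

Lemma nested1 i A : A != set0 -> A != [set i] -> nested [set i] A = (i \in A).
Proof.
move=> A0 Ai; rewrite /nested sub1set subset1.
by rewrite (negbTE A0) (negbTE Ai) !orbF.
Qed.

(** The sets nested with A are the subsets of A and the complements of subsets of [~: A]; the two
    families share only A, whence the successor. *)
Lemma card_nested A :
  #|[set B | nested A B]|.+1 = (2 ^ #|A| + 2 ^ #|~: A|)%N.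
Proof.
have -> : [set B | nested A B] = powerset A :|: [set ~: B | B in powerset (~: A)].
  apply/setP => B; rewrite !inE orbC; congr orb; apply/idP/imsetP => [AB|[C]].
    by exists (~: B); rewrite ?inE ?setCS ?setCK.
  by rewrite inE -setCS setCK => AC ->.
rewrite cardsU card_powerset (card_imset _ (@setC_inj T)) card_powerset.
have -> : powerset A :&: [set ~: B | B in powerset (~: A)] = [set A].
  apply/setP => B; rewrite !inE; apply/andP/eqP => [[BA /imsetP[C]]|->].
    rewrite inE -setCS setCK => AC BE; apply/eqP; rewrite eqEsubset BA.
    by rewrite BE.
  by split=> //; apply/imsetP; exists (~: A); rewrite ?inE ?setCK.
rewrite cards1 subn1 prednK // addn_gt0 expn_gt0 //.
Qed.

(** For fixed s + t, the sum of powers determines the product (2^s - 1)(2^t - 1), which vanishes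
    exactly when s or t is 0. *)
Lemma pow2_split (s t : nat) :
  (2 * ((2 ^ s - 1) * (2 ^ t - 1)) + 2 ^ s.+1 + 2 ^ t.+1 =
   2 ^ (s + t).+1 + 2)%N.
Proof.
have := expn_gt0 2 s; have := expn_gt0 2 t; rewrite !expnS expnD /=.
nia.
Qed.

Section Automorphism.
Variable g : {set T} -> {set T}.
Hypotheses (g_inj : injective g) (g_nested : forall A B, nested (g A) (g B) = nested A B).

Lemma card_nested_aut A : #|[set B | nested (g A) B]| = #|[set B | nested A B]|.
Proof.
have [h gK hK] := injF_bij g_inj.
rewrite -[RHS](card_imset _ g_inj); apply: eq_card => B; rewrite inE.
apply/idP/imsetP => [|[C]]; last by rewrite inE -g_nested => AC ->.
by exists (h B); rewrite ?hK // inE -g_nested hK.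
Qed.

(* The number 2^p + 2^q - 1 of sets nested with A, where p + q = #|T|, detects
   whether p or q is 1 because of [pow2_split]. *)
Lemma card1_aut A : (0 < #|A|)%N -> (0 < #|~: A|)%N ->
  (0 < #|g A|)%N -> (0 < #|~: g A|)%N ->
  (#|A| == 1) || (#|~: A| == 1) = (#|g A| == 1) || (#|~: g A| == 1).
Proof.
move=> A0 A1 g0 g1.
have := congr1 S (card_nested_aut A); rewrite !card_nested.
have := cardsC A; have := cardsC (g A).
move: A0 A1 g0 g1.
move: #|A| #|~: A| #|g A| #|~: g A| => [|a] [|b] [|c] [|e] // _ _ _ _ ce ab E.
have := pow2_split a b; have := pow2_split c e.
have -> : (c + e = a + b)%N by lia.
have z (m : nat) : (2 ^ m - 1 == 0)%N = (m == 0).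
  by rewrite subn_eq0; case: m => // m; rewrite expnS; have := expn_gt0 2 m; lia.
have : ((2 ^ a - 1) * (2 ^ b - 1) == 0)%N = (a == 0) || (b == 0).
  by rewrite muln_eq0 !z.
have : ((2 ^ c - 1) * (2 ^ e - 1) == 0)%N = (c == 0) || (e == 0).
  by rewrite muln_eq0 !z.
rewrite !eqSS => <- <- h1 h2; congr (_ == 0)%N; lia.
Qed.

(** A point j outside a nonempty A gives a singleton not nested with A. *)
Lemma nested_all A : (forall B, nested A B) -> A = set0 \/ A = setT.
Proof.
move=> h.
have [->|[i iA]] := set_0Vmem A; first by left.
right; apply/eqP; rewrite -subTset; apply/subsetP => j _; apply: contraT => jA.
have := h [set j]; rewrite nestedC nested1 ?(negbTE jA) //.
  by apply/set0Pn; exists i.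
by apply: contra jA => /eqP ->; rewrite inE.
Qed.

Lemma nested_aut_proper A : A != set0 -> A != setT -> g A != set0 /\ g A != setT.
Proof.
move=> A0 AT; have [h gK hK] := injF_bij g_inj.
suff: ~ (forall B, nested (g A) B).
  by move=> n; split; apply/eqP => e; apply: n => B; rewrite /nested e
    ?sub0set ?subsetT ?orbT.
move=> n; case: (@nested_all A) => [B|e|e]; last 2 first.
- by rewrite e eqxx in A0.
- by rewrite e eqxx in AT.
by rewrite -g_nested.
Qed.

(** A set is recovered from the singletons nested with it: for A proper and not a singleton, i is in
    A iff {i} is nested with A, and g carries this to {s i} and g A. *)
Lemma nested_aut_singletons : (forall i, #|g [set i]| = 1) ->
  exists s : {perm T}, forall A, A != set0 -> A != setT -> g A = s @: A.
Proof.
move=> g1.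
have ex i : {j | g [set i] == [set j]}.
  by apply: sigW; have /eqP/cards1P[j ->] := g1 i; exists j.
pose s i := sval (ex i).
have sE i : g [set i] = [set s i] by apply/eqP; rewrite /s; case: (ex i).
have s_inj : injective s.
  by move=> i j e; apply/set1_inj/g_inj; rewrite !sE e.
exists (perm s_inj) => A A0 AT.
have [gA0 gAT] := nested_aut_proper A0 AT.
have [/cards1P[i ->]|A1] := boolP (#|A| == 1).
  by rewrite imset_set1 permE sE.
have A1' i : A != [set i] by apply: contra A1 => /eqP ->; rewrite cards1.
apply/setP => j; rewrite -(permKV (perm s_inj) j) mem_imset; last exact: perm_inj.
move: (_ j) => i; rewrite permE -(nested1 A0 (A1' i)) -g_nested sE nested1 //.
by rewrite -sE (inj_eq g_inj).
Qed.

End Automorphism.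

Lemma exists_third i j : exists l, l != i /\ l != j.
Proof.
have : (0 < #|~: [set i; j]|)%N.
  have := cardsC [set i; j]; have := T3; rewrite cards2.
  by case: (i != j) => /=; lia.
by case/card_gt0P => l; rewrite !inE negb_or => /andP[]; exists l.
Qed.

(** By counting, g permutes the singletons and their complements among themselves. If it sends
    singletons to singletons, they define the permutation; otherwise its composite with
    complementation does. *)
Lemma nested_aut (g : {set T} -> {set T}) : injective g ->
  (forall A B, nested (g A) (g B) = nested A B) ->
  exists s : {perm T}, (forall A, A != set0 -> A != setT -> g A = s @: A) \/
    (forall A, A != set0 -> A != setT -> g A = ~: (s @: A)).
Proof.
move=> g_inj g_nested.
have card1_proper i : [set i] != set0 /\ [set i] != setT.
  split; first by apply/set0Pn; exists i; rewrite inE.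
  by apply: contraTneq T3 => e; rewrite -cardsT -e cards1.
have pos (A : {set T}) : A != set0 -> A != setT -> (0 < #|A|)%N /\ (0 < #|~: A|)%N.
  by move=> A0 AT; rewrite !card_gt0 A0 -[_ == set0](inj_eq (@setC_inj T)) setCK setC0.
have C0 (A : {set T}) : (~: A != set0) = (A != setT).
  by rewrite -(inj_eq (@setC_inj T)) setCK setC0.
have CT (A : {set T}) : (~: A != setT) = (A != set0).
  by rewrite -(inj_eq (@setC_inj T)) setCK setCT.
have ext A : A != set0 -> A != setT -> (#|A| == 1) || (#|~: A| == 1) ->
    (#|g A| == 1) || (#|~: g A| == 1).
  move=> A0 AT; have [a b] := pos _ A0 AT.
  have [g0 gT] := nested_aut_proper g_inj g_nested A0 AT.
  by have [c e] := pos _ g0 gT; rewrite (card1_aut g_inj g_nested).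
have cc (A B : {set T}) : A != B -> nested A B -> #|A| == 1 -> #|B| == 1 -> False.
  move=> AB; rewrite /nested => /orP[]/subset_leqif_cards[_ e] /eqP a /eqP b.
    by rewrite -e a b in AB.
  by rewrite eq_sym -e a b in AB.
have cC (i j : T) : i != j -> nested [set i] (~: [set j]) /\ [set i] != ~: [set j].
  move=> ij; split; first by rewrite /nested sub1set !inE ij.
  apply/eqP => /(congr1 (fun A : {set T} => #|A|)); rewrite cards1 cardsC1; lia.
(* All singletons behave alike. For j other than i and l, the complement of {j} is nested with both
   {i} and {l}, while distinct nested sets are neither two singletons nor two complements of
   singletons. So g (~: {j}) has the type opposite to both g {i} and g {l}. *)
have step (i l : T) : #|g [set i]| == 1 -> #|g [set l]| == 1.
  move=> gi; have [j [ji jl]] := exists_third i l.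
  have /= j1 := ext (~: [set j]); rewrite C0 CT setCK cards1 orbT in j1.
  have [p0 pT] := card1_proper j; have {}j1 := j1 pT p0 isT.
  have [l0 lT] := card1_proper l; have := ext _ l0 lT; rewrite cards1 => /(_ isT).
  case/orP => // lC.
  case/orP: j1 => jC.
    rewrite eq_sym in ji; have [c n] := cC i j ji.
    by case: (cc (g [set i]) (g (~: [set j]))); rewrite ?g_nested ?(inj_eq g_inj).
  rewrite eq_sym in jl; have [c n] := cC l j jl.
  case: (cc (~: g [set l]) (~: g (~: [set j]))) => //.
    by rewrite (inj_eq (@setC_inj T)) (inj_eq g_inj).
  by rewrite nested_setC g_nested.
have [i0 _] : exists i, i \in T by apply/card_gt0P; apply: leq_trans T3.
have [/eqP a|a] := boolP (#|g [set i0]| == 1).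
  have [|s sE] := nested_aut_singletons g_inj g_nested; last by exists s; left.
  by move=> i; apply/eqP/(@step i0)/eqP.
have [||i|s sE] := @nested_aut_singletons (fun A => ~: g A).
- by move=> A B /(@setC_inj T)/g_inj.
- by move=> A B; rewrite nested_setC.
- have [l0 lT] := card1_proper i; have := ext _ l0 lT; rewrite cards1 => /(_ isT).
  by case/orP => [/(@step i i0)|/eqP//]; rewrite (negbTE a).
by exists s; right => A A0 AT; rewrite -sE // setCK.
Qed.

End Comparability.

(** * Determinant and index *)

(** Column 0 has two nonzero entries, k_0 + 1 and -k_0, whose minors are triangular with diagonal
    entries k_i + 1 and -k_i respectively. *)
Lemma det_M d (k : 'I_d.+1 -> nat) : (0 < d)%N ->
  \det (M k) = (\prod_i (k i).+1)%:Z - (\prod_i k i)%:Z.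
Proof.
move=> d0; rewrite (expand_det_col _ ord0).
have m0 : ord_max != ord0 :> 'I_d.+1 by rewrite -val_eqE /= -lt0n.
have Smax : ordS (ord_max : 'I_d.+1) = ord0 by apply: val_inj; rewrite /= modnn.
have lS (i : 'I_d.+1) : i != ord_max -> ordS i = i.+1 :> nat.
  rewrite -val_eqE /= => im; have := ltn_ord i => id.
  by rewrite modn_small //; lia.
rewrite (bigD1 ord0) //= (bigD1 ord_max) //= big1 ?addr0 => [|i /andP[i0 im]]; last first.
  rewrite mxE eq_sym (negbTE i0) ifN ?mul0r //.
  by apply/eqP => /(congr1 (@nat_of_ord _)); rewrite lS.
rewrite !mxE eqxx eq_sym (negbTE m0) Smax eqxx /cofactor.
have l0i (i : 'I_d) : lift ord0 i = i.+1 :> nat := lift0 i.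
have lmi (i : 'I_d) : lift ord_max i = i :> nat := lift_max i.
have lm (i : 'I_d) : lift ord_max i != ord_max by rewrite eq_sym neq_lift.
have eqE (i j : 'I_d.+1) : (i == j) = (i == j :> nat) by [].
rewrite -[\det (row' ord0 _)]det_tr !det_trig; last 2 first.
- apply/is_trig_mxP => i j ij; rewrite !mxE !eqE lmi l0i lS // lmi.
  by rewrite eqSS !gtn_eqF // (ltn_trans ij).
- apply/is_trig_mxP => i j ij; rewrite !mxE !eqE !l0i.
  have [jm|jm] := eqVneq (lift ord0 j) ord_max.
    by rewrite jm Smax eqSS ltn_eqF.
  by rewrite lS // l0i !eqSS !ltn_eqF // (ltn_trans ij).
rewrite (eq_bigr (fun i => (k (lift ord0 i)).+1%:Z)); last first.
  by move=> i _; rewrite !mxE eqxx.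
rewrite [in X in _ + X](eq_bigr (fun i => - (k (lift ord0 i))%:Z)); last first.
  move=> i _; rewrite !mxE eqE l0i lmi gtn_eqF //.
  have -> : ordS (lift ord_max i) = lift ord0 i.
    by apply: ord_inj; rewrite lS // lmi l0i.
  by rewrite eqxx.
(* The cofactor sign (-1)^d cancels the signs of the d diagonal entries -k_i. *)
rewrite prodrN cardT size_enum_ord expr0 mul1r addn0.
rewrite [(_ ^+ _ * (_ * _))]mulrA -exprD addnn -signr_odd odd_double expr0 mul1r.
by rewrite mulNr !big_ord_recl !PoszM !(big_morph _ PoszM (erefl 1)).
Qed.

Lemma eq_residue (t c : int) (a b : nat) : (a < absz t)%N -> (b < absz t)%N ->
  a%:Z - b%:Z = c * t -> a = b.
Proof.
move=> at_ bt E; have [c0|c1] : c = 0 \/ (0 < absz c)%N by lia.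
  by move: E; rewrite c0 mul0r; lia.
have := congr1 absz E; rewrite abszM; nia.
Qed.

(** Write B = P D Q in Smith normal form. The integer points of the box with sides |s_i| represent
    the classes modulo D, and multiplying them by Q gives representatives modulo B; their number is
    the product of the |s_i|. *)
Lemma lattice_transversal n (B : 'M[int]_n) : \det B != 0 ->
  exists (X : finType) (dec : X -> 'rV[int]_n),
    [/\ #|X|%:Z = `|\det B|,
        forall x y, (exists b, dec x - dec y = b *m B) -> x = y &
        forall a, exists x b, a - dec x = b *m B].
Proof.
move=> B0.
have [P uP [Q uQ [s _ BE]]] := int_Smith_normal_form B.
pose D := (\matrix_(i, j) (s`_i *+ (i == j :> nat))) : 'M[int]_n.
have detD : \det D = \prod_(i < n) s`_i.
  rewrite det_trig; last first.
    by apply/is_trig_mxP => i j ij; rewrite mxE ltn_eqF.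
  by apply: eq_bigr => i _; rewrite mxE eqxx.
have unit1 (U : 'M[int]_n) : U \in unitmx -> `|\det U| = 1.
  by rewrite unitmxE => /orP[]/eqP->.
have absB : `|\det B| = \prod_(i < n) `|s`_i|.
  by rewrite BE !det_mulmx !normrM (unit1 _ uP) (unit1 _ uQ) mulr1 mul1r detD normr_prod.
have s0 (i : 'I_n) : (0 < absz (s`_i)%R)%N.
  rewrite absz_gt0; apply: contraNneq B0 => si.
  by rewrite -normr_eq0 absB (bigD1 i) //= si normr0 mul0r.
have mulD (b : 'rV_n) i : (b *m D) 0 i = b 0 i * s`_i.
  rewrite mxE (bigD1 i) //= mxE eqxx big1 ?addr0 // => j ji.
  by rewrite mxE (_ : (j == i :> nat) = false) ?mulr0 //; apply/negbTE: ji.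
pose X := {dffun forall i : 'I_n, 'I_(absz (s`_i)%R)}.
pose row (x : X) : 'rV[int]_n := \row_i (x i : nat)%:Z.
exists X, (fun x => row x *m Q); split.
- rewrite card_dep_ffun absB foldrE big_map big_enum /=.
  rewrite (big_morph _ PoszM (erefl 1)); apply: eq_bigr => i _.
  by rewrite card_ord abszE.
- move=> x y [b]; rewrite -mulmxBl BE !mulmxA => /(congr1 (mulmxr (invmx Q))).
  rewrite /= !mulmxK //; move: (b *m P) => c E.
  apply/ffunP => i; apply: val_inj.
  have := congr1 (fun v : 'rV_n => v 0 i) E; rewrite mulD !mxE.
  exact: eq_residue (ltn_ord _) (ltn_ord _).
- move=> a; have [a' ->] : exists a', a = a' *m Q.
    by exists (a *m invmx Q); rewrite mulmxKV.
  have lt (i : 'I_n) : (absz ((a' 0 i)%R %% (s`_i)%R)%Z < absz (s`_i)%R)%N.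
    by rewrite -ltz_nat gez0_abs ?modz_ge0 ?ltz_mod -?absz_gt0.
  exists (finfun (fun i => Ordinal (lt i)) : X).
  exists ((\row_i ((a' 0 i)%R %/ (s`_i)%R)%Z) *m invmx P).
  rewrite BE !mulmxA mulmxKV // -mulmxBl; congr mulmx.
  apply/rowP => i; rewrite mulD !mxE ffunE /= gez0_abs; last first.
    by rewrite modz_ge0 -?absz_gt0.
  by apply/eqP; rewrite subr_eq -divz_eq.
Qed.

From mathcomp Require Import all_classical all_reals.
Local Open Scope classical_set_scope.

Local Notation coord := Defs.coord.

(** * Cells *)

Section Geometry.
Variables (R : realType) (d : nat).
Implicit Types (a b c : 'rV[int]_d.+1) (x y z t : V R d).

Definition vec a : V R d := \sum_i wt R i *~ a 0 i.

Lemma vec0 : vec 0 = 0.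
Proof. by rewrite /vec big1 // => i _; rewrite mxE mulr0z. Qed.
Lemma vecD a b : vec (a + b) = vec a + vec b.
Proof. by rewrite -big_split; apply: eq_bigr => i _; rewrite mxE mulrzDr. Qed.
Lemma vecN a : vec (- a) = - vec a.
Proof. by rewrite -sumrN; apply: eq_bigr => i _; rewrite mxE mulrNz. Qed.
Lemma vecB a b : vec (a - b) = vec a - vec b.
Proof. by rewrite vecD vecN. Qed.

Lemma coordD x y j : coord (x + y) j = coord x j + coord y j.
Proof. by rewrite /coord mxE. Qed.
Lemma coordN x j : coord (- x) j = - coord x j.
Proof. by rewrite /coord mxE. Qed.
Lemma coordZ (s : R) x j : coord (s *: x) j = s * coord x j.
Proof. by rewrite /coord mxE. Qed.

Lemma coord_vec a j : coord (vec a) j =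
  (a 0 j)%:~R - (d.+1%:R)^-1 * \sum_i (a 0 i)%:~R :> R.
Proof.
have E (i : 'I_d.+1) : coord (wt R i) j = (j == i)%:R - (d.+1%:R)^-1.
  rewrite /coord /= !mxE summxE eqxx /= (bigD1 j) //= mxE !eqxx big1 ?addr0 ?mulr1 //.
  by move=> l lj; rewrite mxE eq_sym (negbTE lj) andbF.
have c0 : coord (0 : V R d) j = 0 by rewrite /coord mxE.
rewrite /vec (big_morph (fun x => coord x j) (fun x y => coordD x y j) c0).
rewrite (eq_bigr (fun i => (a 0 i)%:~R *+ (j == i) - (d.+1%:R)^-1 * (a 0 i)%:~R)).
  rewrite sumrB -mulr_sumr (bigD1 j) //= eqxx big1 ?addr0 // => i ij.
  by rewrite eq_sym (negbTE ij).
move=> i _; rewrite -[_ *~ _](@scaler_int R) coordZ E mulrBr mulr_natr.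
by rewrite [_^-1 * _]mulrC.
Qed.

Lemma coordB_vec a i j :
  coord (vec a) j - coord (vec a) i = (a 0 j - a 0 i)%:~R.
Proof.
by rewrite !coord_vec rmorphB opprB addrA subrK.
Qed.

Lemma vec_eq0 a : vec a = 0 -> a = const_mx (a 0 ord0).
Proof.
move=> a0; apply/rowP => j; rewrite mxE.
have := coordB_vec a ord0 j; rewrite a0 /coord !mxE subrr => /esym/eqP.
by rewrite intr_eq0 subr_eq0 => /eqP.
Qed.

Lemma LambdaP x : Lambda R d x <-> exists a, x = vec a.
Proof. by []. Qed.

Lemma Lambda_vec a : Lambda R d (vec a). Proof. by exists a. Qed.

(** Exchanging i and j and negating m turns lower bounds into upper bounds, so one kind of
    inequality over all ordered pairs suffices. *)
Lemma cellP x y : closed_cell x y <-> forall i j (m : int),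
  coord x j - coord x i <= m%:~R -> coord y j - coord y i <= m%:~R.
Proof.
split=> h i j m; last first.
  move=> _; split=> [|H]; first exact: h.
  by rewrite -lerN2 -rmorphN opprB /=; apply: h; rewrite -opprB rmorphN lerN2.
have [ij|ji|/val_inj->] := ltngtP i j; first by case: (h i j m ij).
  move=> H; rewrite -lerN2 -rmorphN opprB /=.
  by case: (h j i (- m) ji) => _; apply; rewrite -opprB rmorphN lerN2.
by rewrite !subrr.
Qed.

(** On a closed cell x_j - x_i stays between two consecutive integers, the floor of its value at x
    and the next one. *)
Lemma cell_vec x a b i j : closed_cell x (vec a) -> closed_cell x (vec b) ->
  (b 0 j - b 0 i) - (a 0 j - a 0 i) <= 1%:Z.
Proof.
move=> /cellP ha /cellP hb.
pose f := Num.floor (coord x j - coord x i).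
have fle : f%:~R <= coord x j - coord x i by exact: floor_le.
have flt : coord x j - coord x i <= (f + 1)%:~R by exact/ltW/floorD1_gt.
have h1 := hb i j _ flt; rewrite coordB_vec ler_int in h1.
have := ha j i (- f); rewrite coordB_vec ler_int rmorphN -[coord x i - _]opprB lerN2.
move=> /(_ fle); lia.
Qed.

(** Subtracting the minimal entry leaves only 0 and 1, and the index l of a minimum stays outside
    S. *)
Lemma spread_ind c : (forall i j, c 0 j - c 0 i <= 1%:Z) ->
  exists2 S : {set 'I_d.+1}, S != [set: 'I_d.+1]%SET &
    exists m, c = ind S + const_mx m.
Proof.
move=> h; have [l] := exists_max (- c) => lm.
exists [set j | c 0 j != c 0 l]%SET.
  by apply/eqP => /setP/(_ l); rewrite !inE eqxx.
exists (c 0 l); apply/rowP => j; rewrite !mxE inE.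
have := lm j; have := h l j; rewrite !mxE.
by case: eqP => /= [->|]; rewrite ?mulr0n ?mulr1n; lia.
Qed.

(** Taking i in A but not B, and j in B but not A, would make the difference equal to 2. *)
Lemma ind_spread_nested (A B : {set 'I_d.+1}) :
  (forall i j, (ind A 0 j - ind A 0 i) - (ind B 0 j - ind B 0 i) <= 1%:Z) ->
  nested A B.
Proof.
move=> h; rewrite /nested; apply: contraT; rewrite negb_or.
case/andP=> /subsetPn[i iA iB] /subsetPn[j jB jA].
by have := h j i; rewrite !mxE iA jB (negbTE iB) (negbTE jA).
Qed.

(* The barycentre of the triangle lies in the relative interior of a cell of
   which the three points are vertices. *)
Lemma chain_cell a (A B : {set 'I_d.+1}) : A \subset B -> exists x,
  [/\ closed_cell x (vec a), closed_cell x (vec (a + ind A)) &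
      closed_cell x (vec (a + ind B))].
Proof.
move=> AB; pose s := a + a + a + ind A + ind B.
exists ((3%:~R : R)^-1 *: vec s).
have h b : (forall i j (m : int), s 0 j - s 0 i <= 3 * m ->
    b 0 j - b 0 i <= m) -> closed_cell ((3%:~R : R)^-1 *: vec s) (vec b).
  move=> hb; apply/cellP => i j m.
  rewrite !coordZ -mulrBr !coordB_vec ler_int ler_pdivrMl ?ltr0z //.
  by rewrite -rmorphM ler_int; apply: hb.
(* As A is contained in B, the (i, j) differences at the three points take at most two consecutive
   integer values; if their mean is at most m, so is each of them. *)
by split; apply: h => i j m; rewrite !mxE;
  have := fintype.subsetP AB i; have := fintype.subsetP AB j;
  case: (i \in A) (j \in A) (i \in B) (j \in B) => [] [] [] [] /=;
  move=> // h1 h2; try (by have := h1 isT); try (by have := h2 isT); lia.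
Qed.

End Geometry.

(** * The torus and its automorphisms *)

Section Torus.
Variables (R : realType) (d : nat) (k : 'I_d.+1 -> nat).
Hypotheses (hd : (2 <= d)%N) (kpos : forall i, (0 < k i)%N).
Implicit Types (a b c : 'rV[int]_d.+1) (x y z t : V R d) (u v w : Tvertex R k).
Implicit Types (f g : Tvertex R k -> Tvertex R k) (phi psi : V R d -> V R d).
Local Notation vec := (@vec R d).
Local Notation L := (@L R d k).

(** The kernel of [vec] consists of constant vectors, which the row lattice contains, so classes
    modulo L can be handled in Z^(d+1). *)
Lemma L_vecE a : L (vec a) <-> rowlat k a.
Proof.
split=> [[b E]|[b ->]]; last by exists b.
have {}E : vec (a - b *m M k) = 0 by rewrite vecB E subrr.
have -> : a = (a - b *m M k) + b *m M k by rewrite subrK.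
apply: rowlatD; last by exists b.
by rewrite (vec_eq0 E); apply: rowlat_const.
Qed.

Lemma L0 : L 0. Proof. by rewrite -[0](vec0 R d) L_vecE; apply: rowlat0. Qed.
Lemma LD x y : L x -> L y -> L (x + y).
Proof.
by move=> [a ->] [b ->]; exists (a + b); rewrite -[LHS]vecD mulmxDl.
Qed.
Lemma LN x : L x -> L (- x).
Proof. by move=> [a ->]; exists (- a); rewrite -[LHS]vecN mulNmx. Qed.

Lemma class_eq x y : L (y - x) -> class_of k x = class_of k y.
Proof.
move=> xy; apply/seteqP; split=> z /= h.
  by rewrite /class_of /= -(subrKA x) -[x - y]opprB; apply/LD/LN.
by rewrite /class_of /= -(subrKA y); apply: LD.
Qed.

Lemma class_self x : class_of k x x.
Proof. by rewrite /class_of /= subrr; apply: L0. Qed.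

Definition tvertex x (Lx : Lambda R d x) : Tvertex R k :=
  exist _ (class_of k x) (mem_set (imageP (class_of k) Lx)).

Definition vert a : Tvertex R k := tvertex (Lambda_vec R a).

Lemma vertexP u : exists2 x, Lambda R d x & val u = class_of k x.
Proof. by case: u => A /[dup]; rewrite {1}inE => -[x Lx <-] h; exists x. Qed.

Lemma vertex_class u x : val u x -> val u = class_of k x.
Proof. by have [y _ ->] := vertexP u; apply: class_eq. Qed.

Lemma vertex_eq u w x : val u x -> val w x -> u = w.
Proof.
by move=> /vertex_class ux /vertex_class wx; apply: val_inj; rewrite ux wx.
Qed.

Lemma vertex_Lambda u x : val u x -> Lambda R d x.
Proof.
have [y /LambdaP[a ->] ->] := vertexP u.
move=> [b E]; apply/LambdaP; exists (b *m M k + a).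
by rewrite vecD -[x](subrK (vec a)) E.
Qed.

Lemma mem_vert a : val (vert a) (vec a). Proof. exact: class_self. Qed.

Lemma vert_surj u x : val u x -> exists2 a, u = vert a & x = vec a.
Proof.
move=> ux; have /LambdaP[a xa] := vertex_Lambda ux; exists a => //.
by apply: (vertex_eq ux); rewrite xa; apply: mem_vert.
Qed.

Lemma vert_ex u : exists a, u = vert a.
Proof.
have [x _ ux] := vertexP u.
have /vert_surj[a] : val u x by rewrite ux; apply: class_self.
by exists a.
Qed.

Lemma vert_eq a b : vert a = vert b <-> rowlat k (a - b).
Proof.
rewrite -L_vecE vecB; split=> [E|h].
  by have := mem_vert a; rewrite E.
by apply: (@vertex_eq _ _ (vec a)); [exact: mem_vert|exact: h].
Qed.

Lemma vert_const a m : vert (a + const_mx m) = vert a.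
Proof. by apply/vert_eq; rewrite addrC addKr; apply: rowlat_const. Qed.

Lemma vert_ind_inj a (S T : {set 'I_d.+1}) : S != [set: 'I_d.+1]%SET ->
  T != [set: 'I_d.+1]%SET -> vert (a + ind S) = vert (a + ind T) -> S = T.
Proof.
move=> ST TT /vert_eq; rewrite opprD addrACA subrr add0r.
exact: rowlat_ind_inj.
Qed.

Lemma TfaceP (S : set (Tvertex R k)) : Tface R k S <-> exists x,
  S = [set u | exists2 y, closed_cell x y & val u y].
Proof.
have E x : [set u : Tvertex R k | exists2 v, (closed_cell x `&` Lambda R d) v &
    val u = class_of k v] = [set u | exists2 y, closed_cell x y & val u y].
  apply/seteqP; split=> u /= [y].
    by move=> [xy _] uy; exists y => //; rewrite uy; apply: class_self.
  move=> xy uy; exists y; last exact: vertex_class.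
  by split=> //; apply: vertex_Lambda uy.
split=> [[s [x ->] ->]|[x ->]]; first by exists x; rewrite E.
by exists (closed_cell x `&` Lambda R d); [exists x|rewrite E].
Qed.

(** * Maps of V that descend to the torus *)

Definition compatible phi := [/\ forall x y, closed_cell x y ->
    closed_cell (phi x) (phi y), forall x, Lambda R d x -> Lambda R d (phi x) &
  forall x y, L (x - y) -> L (phi x - phi y)].

Lemma induced_ex phi : compatible phi -> exists f, induces phi f.
Proof.
move=> [_ pL pk].
suff /choice[f fE] : forall u, exists w, forall x, val u x -> val w (phi x).
  by exists f.
move=> u; have [x Lx ux] := vertexP u.
by exists (tvertex (pL _ Lx)) => y; rewrite ux; apply: pk.
Qed.

Lemma induces_uniq phi f g : induces phi f -> induces phi g -> f = g.
Proof.
move=> fp gp; apply/funext => u; have [x _ ux] := vertexP u.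
have h : val u x by rewrite ux; apply: class_self.
by apply: (@vertex_eq _ _ (phi x)); [apply: fp|apply: gp].
Qed.

Lemma induces_comp phi psi f g :
  induces phi f -> induces psi g -> induces (phi \o psi) (f \o g).
Proof. by move=> fp gp u x ux; apply/fp/gp. Qed.

Lemma induces_id : induces id (@id (Tvertex R k)). Proof. by []. Qed.

Lemma induced_face phi psi f (S : set (Tvertex R k)) :
  compatible phi -> compatible psi -> cancel phi psi -> cancel psi phi ->
  induces phi f -> Tface R k S -> Tface R k (f @` S).
Proof.
move=> cp cq pK qK fp /TfaceP[x ->]; apply/TfaceP; exists (phi x).
apply/seteqP; split=> [_ [u /= [y xy uy] <-]|w /= [y xy wy]].
  by exists (phi y); [case: cp => cp _ _; apply: cp|apply: fp].
have yL : Lambda R d (psi y) by case: cq => _ h _; apply/h/(vertex_Lambda wy).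
exists (tvertex yL); last first.
  apply: (@vertex_eq _ _ y) => //; rewrite -[y in val _ y]qK; apply: fp.
  exact: class_self.
exists (psi y); last exact: class_self.
by rewrite -(pK x); case: cq => h _ _; apply: h.
Qed.

Lemma induced_AutT phi psi f : compatible phi -> compatible psi ->
  cancel phi psi -> cancel psi phi -> induces phi f -> AutT R k f.
Proof.
move=> cp cq pK qK fp; have [g gq] := induced_ex cq.
have gfE : g \o f = id.
  by apply: induces_uniq (induces_comp gq fp) _ => u x; rewrite /= pK.
have fgE : f \o g = id.
  by apply: induces_uniq (induces_comp fp gq) _ => u x; rewrite /= qK.
split; first by exists g => u; [exact: (congr1 (fun h => h u) gfE)|exact: (congr1 (fun h => h u) fgE)].
move=> S; split; last exact: (induced_face cp cq).
move=> /(induced_face cq cp qK pK gq); by rewrite image_comp gfE image_id.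
Qed.

(** * Vertex stars and their rigidity *)

Definition coface u v w := exists S, [/\ Tface R k S, S u, S v & S w].

Lemma AutT_id : AutT R k id.
Proof. by split=> [|S]; [exists id|rewrite image_id]. Qed.

Lemma AutT_comp f g : AutT R k f -> AutT R k g -> AutT R k (f \o g).
Proof.
move=> [bf hf] [bg hg]; split; first exact: bij_comp.
by move=> S; rewrite -image_comp hf hg.
Qed.

Lemma AutT_inv f : AutT R k f ->
  exists g, [/\ AutT R k g, cancel f g & cancel g f].
Proof.
move=> [[g fK gK] h]; exists g; split=> //; split; first by exists f.
move=> S; rewrite -h image_comp (_ : f \o g = id) ?image_id //.
exact/funext.
Qed.

Lemma AutT_group : is_transf_group (@AutT R d k).
Proof. by split; [exact: AutT_id|exact: AutT_comp|exact: AutT_inv]. Qed.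

Lemma coface_aut f u v w : AutT R k f -> coface u v w ->
  coface (f u) (f v) (f w).
Proof.
move=> [_ h] [S [FS Su Sv Sw]]; exists (f @` S).
by split; [apply/h|exists u|exists v|exists w].
Qed.

Lemma coface_autE f u v w : AutT R k f ->
  coface (f u) (f v) (f w) <-> coface u v w.
Proof.
move=> hf; split; last exact: coface_aut.
have [g [hg fK gK]] := AutT_inv hf.
by move=> /(coface_aut hg); rewrite !fK.
Qed.

Lemma coface_chain a (A B : {set 'I_d.+1}) : A \subset B ->
  coface (vert a) (vert (a + ind A)) (vert (a + ind B)).
Proof.
move=> /(chain_cell R a)[x [xa xA xB]].
exists [set u | exists2 y, closed_cell x y & val u y].
split; first by apply/TfaceP; exists x.
- by exists (vec a) => //; apply: mem_vert.
- by exists (vec (a + ind A)) => //; apply: mem_vert.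
- by exists (vec (a + ind B)) => //; apply: mem_vert.
Qed.

Lemma cofaceC u v w : coface u v w -> coface u w v.
Proof. by move=> [S [? ? ? ?]]; exists S. Qed.

(** Lift the three vertices to points a0, a1, a2 of one closed cell. By [cell_vec], a1 - a0 and a2 -
    a0 are indicators up to constants, and comparing a1 with a2 makes the two sets nested. The lift
    a0 differs from a by a lattice vector. *)
Lemma coface_nested a v w : coface (vert a) v w ->
  exists A B : {set 'I_d.+1}, [/\ A != [set: 'I_d.+1]%SET,
    B != [set: 'I_d.+1]%SET, nested A B, v = vert (a + ind A) &
    w = vert (a + ind B)].
Proof.
case=> S [/TfaceP[x ->]] /= [y0 x0 h0] [y1 x1 h1] [y2 x2 h2].
have [a0 a0E e0] := @vert_surj (vert a) _ h0; have [a1 a1E e1] := @vert_surj v _ h1.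
have [a2 a2E e2] := @vert_surj w _ h2; subst y0 y1 y2.
have [A AT [m mE]] : exists2 S : {set 'I_d.+1}, S != [set: 'I_d.+1]%SET &
    exists m, a1 - a0 = ind S + const_mx m.
  apply: spread_ind => i j; have := cell_vec i j x0 x1; rewrite !mxE /=; lia.
have [B BT [n nE]] : exists2 S : {set 'I_d.+1}, S != [set: 'I_d.+1]%SET &
    exists m, a2 - a0 = ind S + const_mx m.
  apply: spread_ind => i j; have := cell_vec i j x0 x2; rewrite !mxE /=; lia.
exists A, B; split=> //.
- apply: ind_spread_nested => i j; have := cell_vec i j x2 x1.
  have ci l : a1 0 l - a0 0 l = ind A 0 l + m.
    by have := congr1 (fun c : 'rV_d.+1 => c 0 l) mE; rewrite !mxE.
  have cj l : a2 0 l - a0 0 l = ind B 0 l + n.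
    by have := congr1 (fun c : 'rV_d.+1 => c 0 l) nE; rewrite !mxE.
  by have := ci i; have := ci j; have := cj i; have := cj j; lia.
- rewrite a1E; apply/vert_eq.
  have -> : a1 - (a + ind A) = - (a - a0) + const_mx m.
    by rewrite -[a1](subrK a0) mE opprB opprD [_ + a0]addrC addrACA [ind A + _]addrC addrK.
  by apply: rowlatD; [apply/rowlatN/vert_eq|apply: rowlat_const].
- rewrite a2E; apply/vert_eq.
  have -> : a2 - (a + ind B) = - (a - a0) + const_mx n.
    by rewrite -[a2](subrK a0) nE opprB opprD [_ + a0]addrC addrACA [ind B + _]addrC addrK.
  by apply: rowlatD; [apply/rowlatN/vert_eq|apply: rowlat_const].
Qed.

(** This translates automorphisms of T_k near a vertex into automorphisms of the nesting
    relation. *)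
Lemma coface_nestedE a (A B : {set 'I_d.+1}) : A != [set: 'I_d.+1]%SET ->
  B != [set: 'I_d.+1]%SET ->
  coface (vert a) (vert (a + ind A)) (vert (a + ind B)) <-> nested A B.
Proof.
move=> AT BT; split=> [|/orP[AB|BA]].
- move=> /coface_nested[A' [B' [A'T B'T h]]].
  by move=> /vert_ind_inj-> // /vert_ind_inj->.
- exact: coface_chain.
- exact/cofaceC/coface_chain.
Qed.

(** On indicators, a change of sign is complementation up to a constant: -ind A = ind (~: A) - 1. *)
Definition local_sign (e : bool) (A : {set 'I_d.+1}) : {set 'I_d.+1} :=
  if e then (~: A)%SET else A.

Lemma star_aut f a b : AutT R k f -> f (vert a) = vert b ->
  exists e (s : 'S_d.+1), forall A : {set 'I_d.+1}, A != finset.set0 ->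
    A != [set: 'I_d.+1]%SET ->
    f (vert (a + ind A)) = vert (b + ind (local_sign e (s @: A)%SET)).
Proof.
move=> hf fab.
(* The full set is mapped to itself by convention: its indicator is constant, so it gives the same
   vertex as the empty set. *)
have /choice[g gE] : forall A : {set 'I_d.+1}, exists B : {set 'I_d.+1},
    (A = [set: 'I_d.+1]%SET -> B = [set: 'I_d.+1]%SET) /\
    (A != [set: 'I_d.+1]%SET -> B != [set: 'I_d.+1]%SET /\
       f (vert (a + ind A)) = vert (b + ind B)).
  move=> A; have [->|AT] := eqVneq A [set: 'I_d.+1]%SET.
    by exists [set: 'I_d.+1]%SET.
  have := coface_aut hf (coface_chain a (fintype.subxx A)); rewrite fab.
  by move=> /coface_nested[B [_ [BT _ _ e _]]]; exists B; split=> [|_] //;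
    move/eqP: AT.
have gT : g [set: 'I_d.+1]%SET = [set: 'I_d.+1]%SET by apply (gE _).1.
have [f' [hf' fK _]] := AutT_inv hf.
have g_inj : injective g.
  move=> A B; have [->|AT] := eqVneq A [set: 'I_d.+1]%SET;
    have [->|BT] := eqVneq B [set: 'I_d.+1]%SET => //.
  - by rewrite gT => e; have [] := (gE B).2 BT; rewrite -e eqxx.
  - by rewrite gT => e; have [] := (gE A).2 AT; rewrite e eqxx.
  have [_ fA] := (gE A).2 AT; have [_ fB] := (gE B).2 BT => e.
  by apply: (@vert_ind_inj a) => //; apply: (can_inj fK); rewrite fA fB e.
have nT (A : {set 'I_d.+1}) : nested A [set: 'I_d.+1]%SET = true.
  by rewrite /nested finset.subsetT.
have g_nested A B : nested (g A) (g B) = nested A B.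
  have [->|AT] := eqVneq A [set: 'I_d.+1]%SET.
    by rewrite gT !(nestedC [set: 'I_d.+1]%SET) !nT.
  have [->|BT] := eqVneq B [set: 'I_d.+1]%SET; first by rewrite gT !nT.
  have [gA fA] := (gE A).2 AT; have [gB fB] := (gE B).2 BT.
  apply/idP/idP => h.
    apply/(@coface_nestedE a) => //; apply/(coface_autE _ _ _ hf).
    by rewrite fab fA fB; apply/coface_nestedE.
  apply/(@coface_nestedE b) => //; rewrite -fab -fA -fB.
  by apply/(coface_autE _ _ _ hf)/coface_nestedE.
have T3 : (2 < #|'I_d.+1|)%N by rewrite card_ord.
have [s [h|h]] := nested_aut T3 g_inj g_nested.
  exists false, s => A A0 AT; have [_ ->] := (gE A).2 AT; by rewrite h.
exists true, s => A A0 AT; have [_ ->] := (gE A).2 AT; by rewrite h.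
Qed.

Lemma ind1 (i : 'I_d.+1) : ind [set i]%SET = delta_mx 0 i.
Proof. by apply/rowP => j; rewrite !mxE inE. Qed.

Lemma ind2 (i j : 'I_d.+1) : i != j -> ind [set i; j]%SET = delta_mx 0 i + delta_mx 0 j.
Proof.
move=> ij; apply/rowP => l; rewrite !mxE !inE /=.
by have [->|] := eqVneq l i; rewrite ?(negbTE ij) // add0r.
Qed.

Lemma proper_set_card (A : {set 'I_d.+1}) : (0 < #|A| < d.+1)%N ->
  A != finset.set0 /\ A != [set: 'I_d.+1]%SET.
Proof.
move=> h; split; apply: contraTneq h => ->; first by rewrite cards0.
by rewrite finset.cardsT card_ord ltnn andbF.
Qed.

Definition star_perm f (s : 'S_d.+1) a b := f (vert a) = vert b /\
  forall A : {set 'I_d.+1}, A != finset.set0 -> A != [set: 'I_d.+1]%SET ->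
    f (vert (a + ind A)) = vert (b + ind (s @: A)%SET).

(* The stars of two adjacent vertices share the vertices a + e_i + e_j, which
   determine the permutation and the sign at the second one. *)
Lemma star_step f s a b i : AutT R k f -> star_perm f s a b ->
  star_perm f s (a + delta_mx 0 i) (b + delta_mx 0 (s i)).
Proof.
move=> hf [fab h].
have p1 (j : 'I_d.+1) := @proper_set_card [set j]%SET.
have fi : f (vert (a + delta_mx 0 i)) = vert (b + delta_mx 0 (s i)).
  by rewrite -!ind1 -imset_set1 h //; case: (p1 i); rewrite ?cards1 //= ltnS ltnW.
have [e [t tE]] := star_aut hf fi.
(* The vertex a + e_i + e_j corresponds to {i, j} seen from a, and to {j} seen from a + e_i. *)
have key j : j != i -> local_sign e [set t j]%SET = [set s j]%SET.
  move=> ji.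
  have [|j0 jT] := p1 j; first by rewrite cards1 /= ltnS ltnW.
  have [|s0 sT] := p1 (s j); first by rewrite cards1 /= ltnS ltnW.
  have ij : i != j by rewrite eq_sym.
  have [|ij0 ijT] := @proper_set_card [set i; j]%SET; first by rewrite cards2 ij.
  have := tE _ j0 jT; rewrite imset_set1 ind1 -addrA -ind2 // h //.
  rewrite imsetU1 imset_set1 ind2 ?(inj_eq perm_inj) // addrA -(ind1 (s j)).
  move=> /vert_ind_inj E; rewrite -E // {E}.
  rewrite /local_sign; case: e {tE}; last first.
    by have [|] := p1 (t j); rewrite ?cards1 //= ltnS ltnW.
  by have [|] := @proper_set_card (~: [set t j])%SET; rewrite ?cardsC1 ?card_ord //=; lia.
have T3 : (2 < #|'I_d.+1|)%N by rewrite card_ord.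
have [j0 [ji _]] := exists_third T3 i i.
(* Otherwise a set with d elements would equal a singleton. *)
have e0 : e = false.
  apply: contraTF hd => eT; have := key j0 ji; rewrite eT /=.
  move=> /(congr1 (fun A : {set 'I_d.+1} => #|A|)).
  by rewrite cardsC1 cards1 card_ord; lia.
rewrite e0 /= in tE key.
have ts j : j != i -> t j = s j by move=> /key/set1_inj.
suff tsE : t = s by split=> // A A0 AT; rewrite tE // tsE.
(* Two permutations that agree off i also agree at i. *)
apply/permP => l; have [->|/ts//] := eqVneq l i.
apply/eqP; apply: contraT => n.
pose m := (s^-1)%g (t i).
have mi : m != i by apply: contra n => /eqP mi; rewrite -{2}mi permKV.
by have := ts m mi; rewrite [s m]permKV => /perm_inj e1; rewrite e1 eqxx in mi.
Qed.

Lemma pact_const s (m : int) : pact s (const_mx m) = const_mx m :> 'rV_d.+1.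
Proof. by apply/rowP => j; rewrite !mxE. Qed.

(** Subtracting its minimal entry from a leaves a sum of unit vectors, reached from 0 by repeated
    use of [star_step]; the constant does not change the vertex. *)
Lemma star_global f s b : AutT R k f -> star_perm f s 0 b ->
  forall a, f (vert a) = vert (b + pact s a).
Proof.
move=> hf h0 a; pose Q c := star_perm f s c (b + pact s c).
have Q0 : Q 0 by rewrite /Q (_ : pact s 0 = 0) ?addr0 //;
  apply/rowP => j; rewrite !mxE.
have Qd c i n : Q c -> Q (c + delta_mx 0 i *+ n).
  move=> Qc; elim: n => [|n IH]; first by rewrite addr0.
  by rewrite mulrSr addrA /Q pactD pact_delta addrA; apply: star_step.
have [l lm] := exists_max (- a).
pose c := \sum_i (delta_mx 0 i *+ absz (a 0 i - a 0 l)%R) : 'rV[int]_d.+1.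
have Qc : Q c.
  rewrite /c; elim: index_enum => [|i r IH]; first by rewrite big_nil.
  by rewrite big_cons addrC; apply: Qd.
have -> : a = c + const_mx (a 0 l).
  apply/rowP => j; rewrite !mxE summxE (bigD1 j) //= big1 ?addr0 => [|i ij].
    have := lm j; rewrite mulmxnE !mxE !eqxx /= mulr1n natz lerN2 => lj.
    by rewrite gez0_abs ?subr_ge0 // subrK.
  by rewrite mulmxnE mxE eq_sym (negbTE ij) andbF mul0rn.
by rewrite vert_const pactD pact_const addrA vert_const; case: Qc.
Qed.


(** * Rotations, signs and affine maps *)

Definition flip (W : zmodType) (e : bool) (x : W) : W := if e then - x else x.

Definition int_rot a : 'rV[int]_d.+1 := \row_j a 0 (ord_pred j).

Lemma vec_rot a : vec (int_rot a) = shift (vec a).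
Proof.
apply: val_inj; apply/rowP => j; rewrite mxE.
rewrite -[LHS]/(coord _ j) -[RHS]/(coord _ (ord_pred j)) !coord_vec mxE.
congr (_ - _ * _); rewrite [RHS](reindex (@ord_pred d.+1)) /=.
  by apply: eq_bigr => i _; rewrite mxE.
by apply: onW_bij; apply: ord_pred_bij.
Qed.

Lemma vec_iter_rot m a : vec (iter m int_rot a) = iter m (@shift R d) (vec a).
Proof. by elim: m => //= m <-; rewrite vec_rot. Qed.

Lemma iter_int_rot m a j : iter m int_rot a 0 j = a 0 (iter m (@ord_pred d.+1) j).
Proof. by elim: m j => //= m IH j; rewrite mxE IH -iterSr. Qed.

Lemma iter_ord_predK m : cancel (iter m (@ord_pred d.+1)) (iter m (@ordS d.+1)).
Proof. by elim: m => // m IH j; rewrite iterSr /= ord_predK IH. Qed.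

(** Commuting with the successor, s is the rotation determined by its value at 0. *)
Lemma pact_rot (s : 'S_d.+1) a : (forall i, s (ordS i) = ordS (s i)) ->
  pact s a = iter (s ord0) int_rot a.
Proof.
move=> h; have sE : forall i, s i = iter (s ord0) (@ordS d.+1) i.
  apply: (@ordS_ind _ _ ord0) => [|i IH]; last by rewrite h IH -iterS iterSr.
  by apply: ord_inj; rewrite iter_ordS add0n modn_small.
apply/rowP => j; rewrite iter_int_rot mxE; congr (a 0 _).
by apply: (@perm_inj _ s); rewrite permKV sE iter_ord_predK.
Qed.

Lemma shiftB x y : shift (x - y) = shift x - shift y.
Proof. by apply: val_inj; apply/rowP => j; rewrite !mxE. Qed.

Lemma iter_shiftB m x y :
  iter m (@shift R d) (x - y) = iter m (@shift R d) x - iter m (@shift R d) y.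
Proof. by elim: m => //= m ->; rewrite shiftB. Qed.

Lemma coord_iter_shift m x j :
  coord (iter m (@shift R d) x) j = coord x (iter m (@ord_pred d.+1) j).
Proof.
elim: m j => //= m IH j.
by rewrite -[LHS]/((shift_row (Vval (iter m (@shift R d) x))) 0 j) mxE
  -[LHS]/(coord _ _) IH -iterSr.
Qed.

Lemma iter_shift_order m x : iter (m * d.+1) (@shift R d) x = x.
Proof.
apply: val_inj; apply/rowP => j.
rewrite -[LHS]/(coord _ j) -[RHS]/(coord _ j) coord_iter_shift; congr (coord x _).
rewrite -{2}[j](iter_ord_predK (m * d.+1)%N).
by apply: ord_inj; rewrite iter_ordS addnC modnMDl modn_small.
Qed.

Definition stable m := forall x, L x -> L (iter m (@shift R d) x).

Definition affine e m t x : V R d := flip e (iter m (@shift R d) x) + t.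

Lemma compatible_comp phi psi :
  compatible phi -> compatible psi -> compatible (phi \o psi).
Proof.
move=> [p1 p2 p3] [q1 q2 q3].
by split=> [x y /q1/p1|x /q2/p2|x y /q3/p3].
Qed.

Lemma compatible_shift m : stable m -> compatible (iter m (@shift R d)).
Proof.
move=> sm; split=> [x y /cellP xy|x /LambdaP[a ->]|x y /sm].
- by apply/cellP => i j n; rewrite !coord_iter_shift; apply: xy.
- by rewrite -vec_iter_rot; apply: Lambda_vec.
- by rewrite iter_shiftB.
Qed.

Lemma compatible_opp : compatible (fun x => - x).
Proof.
split=> [x y /cellP xy|x /LambdaP[a ->]|x y xy].
- apply/cellP => i j n; by rewrite !coordN !opprK ![- _ + _]addrC; apply: xy.
- by rewrite -vecN; apply: Lambda_vec.
- by rewrite -opprD; apply: LN.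
Qed.

Lemma compatible_translation t : Lambda R d t -> compatible (fun x => x + t).
Proof.
move=> /LambdaP[b ->]; split=> [x y /cellP xy|x /LambdaP[a ->]|x y xy].
- apply/cellP => i j n.
  have E z : coord (z + vec b) j - coord (z + vec b) i =
      coord z j - coord z i + (b 0 j - b 0 i)%:~R.
    by rewrite !coordD opprD addrACA coordB_vec.
  by move=> h; rewrite E -lerBrDr -intrB; apply: xy; rewrite intrB lerBrDr -E.
- by rewrite -vecD; apply: Lambda_vec.
- by rewrite opprD addrACA subrr addr0.
Qed.

Lemma compatible_id : compatible id.
Proof. by []. Qed.

Lemma flipK (W : zmodType) e : involutive (@flip W e).
Proof. by case: e => x //=; rewrite opprK. Qed.

Lemma compatible_flip e : compatible (flip e).
Proof. by case: e; [apply: compatible_opp|apply: compatible_id]. Qed.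

(** The exponent m * d gives the inverse rotation, as m + m * d is a multiple of d+1; it is also the
    d-th iterate of the rotation by m, hence preserves L. *)
Lemma stable_inv m : stable m -> stable (m * d).
Proof.
move=> sm x Lx; rewrite mulnC iterM.
suff: forall n, L (iter n (iter m (@shift R d)) x) by apply.
by elim=> //= n; apply: sm.
Qed.

Lemma iter_shiftK m :
  cancel (iter m (@shift R d)) (iter (m * d) (@shift R d)).
Proof. by move=> x; rewrite -iterD addnC -mulnS iter_shift_order. Qed.

Lemma iter_shiftKV m :
  cancel (iter (m * d) (@shift R d)) (iter m (@shift R d)).
Proof. by move=> x; rewrite -iterD -mulnS iter_shift_order. Qed.

Lemma affine_compatible e m t : stable m -> Lambda R d t ->
  compatible (affine e m t).
Proof.
move=> sm Lt; apply: (@compatible_comp (fun x => x + t) (flip e \o _)).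
  exact: compatible_translation.
by apply: compatible_comp; [apply: compatible_flip|apply: compatible_shift].
Qed.

Lemma affine_AutT e m t f : stable m -> Lambda R d t ->
  induces (affine e m t) f -> AutT R k f.
Proof.
move=> sm Lt; apply: (@induced_AutT _ (iter (m * d) (@shift R d) \o
  (flip e \o (fun x => x - t)))).
- exact: affine_compatible.
- apply: compatible_comp; first exact/compatible_shift/stable_inv.
  apply: compatible_comp; first exact: compatible_flip.
  apply: compatible_translation; case/LambdaP: Lt => a ->; rewrite -vecN.
  exact: Lambda_vec.
- by move=> x; rewrite /affine /= addrK flipK iter_shiftK.
- by move=> x; rewrite /affine /= iter_shiftKV flipK subrK.
Qed.

(** * Every automorphism is affine *)

Lemma flip_vec e a : vec (flip e a) = flip e (vec a).
Proof. by case: e; rewrite /= ?vecN. Qed.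

Lemma rowlat_flip e a : rowlat k (flip e a) <-> rowlat k a.
Proof. by case: e => //=; split=> /rowlatN; rewrite ?opprK. Qed.

(** If the star of 0 is mapped with complementation, composing f with the map induced by negation
    removes it, and [star_global] applies to the composite. *)
Lemma AutT_perm f : AutT R k f -> exists e (s : 'S_d.+1) b,
  forall a, f (vert a) = vert (b + flip e (pact s a)).
Proof.
move=> hf; have [b /esym bE] := vert_ex (f (vert 0)).
have [e [s sE]] := star_aut hf (esym bE).
case: e sE => sE; last first.
  by exists false, s, b; apply: star_global.
have [r rE] := induced_ex compatible_opp.
have rv a : r (vert a) = vert (- a).
  apply: (@vertex_eq _ _ (- vec a)); first exact/rE/mem_vert.
  by rewrite -vecN; apply: mem_vert.
have hr : AutT R k r.
  exact: induced_AutT compatible_opp compatible_opp (@opprK _) (@opprK _) rE.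
have hrf := AutT_comp hr hf.
have g a : (r \o f) (vert a) = vert (- b + pact s a).
  apply: star_global hrf _ a; split=> [|A A0 AT] /=; first by rewrite -bE rv.
  rewrite sE // rv -[LHS](vert_const _ 1); congr vert.
  apply/rowP => j; rewrite !mxE !inE.
  by case: (_ \in _) => /=; rewrite ?mulr0n ?mulr1n; lia.
exists true, s, b => a; have [c cE] := vert_ex (f (vert a)).
have := g a; rewrite /= cE rv => /(congr1 r); rewrite !rv opprK => ->.
by rewrite opprD opprK.
Qed.

(** A lattice vector a names the same vertex as 0, hence so do their images, which puts [pact s a]
    in the row lattice. So [perm_rowlat_rot] makes s a rotation. *)
Lemma AutT_affine f : AutT R k f -> exists e (m : 'I_d.+1) a,
  stable m /\ induces (affine e m (vec a)) f.
Proof.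
move=> /AutT_perm[e [s [b fE]]].
have sL a : rowlat k a -> rowlat k (pact s a).
  move=> La; have : vert a = vert 0 by apply/vert_eq; rewrite subr0.
  have p0 : pact s 0 = 0 by apply/rowP => j; rewrite !mxE.
  have f0 : flip e (0 : 'rV[int]_d.+1) = 0 by case: e {fE}; rewrite /= ?oppr0.
  move=> /(congr1 f); rewrite !fE p0 f0 addr0 => /vert_eq.
  by rewrite addrC addKr rowlat_flip.
have rot := pact_rot _ (perm_rowlat_rot hd kpos sL).
exists e, (s ord0), b; split.
  move=> _ [c ->]; rewrite -[X in iter _ _ X]/(vec (c *m M k)) -vec_iter_rot -rot.
  by apply/L_vecE/sL; exists c.
move=> u x ux; have [a -> ->] := vert_surj ux; rewrite fE rot.
rewrite /affine -vec_iter_rot -flip_vec -vecD addrC; exact: mem_vert.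
Qed.

(** * Generators and order of the automorphism group *)

Lemma iter_shift_modn m : iter (m %% d.+1) (@shift R d) = iter m (@shift R d).
Proof.
apply/funext => x; rewrite {2}(divn_eq m d.+1) addnC iterD.
by rewrite iter_shift_order.
Qed.

Lemma iter_rot_delta (m : 'I_d.+1) :
  iter m int_rot (delta_mx 0 ord0) = delta_mx 0 m.
Proof.
apply/rowP => j; rewrite iter_int_rot !mxE !eqxx /=; congr (nat_of_bool _)%:R.
have mE : iter m (@ordS d.+1) ord0 = m.
  by apply: ord_inj; rewrite iter_ordS add0n modn_small.
apply/eqP/eqP => [j0|->]; first by rewrite -(iter_ord_predK m j) j0.
rewrite -{2}mE; elim: {mE}(m : nat) => // n IH.
by rewrite iterSr /= ordSK.
Qed.

Lemma vert_flip_ind e a (A : {set 'I_d.+1}) :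
  vert (a + flip e (ind A)) = vert (a + ind (local_sign e A)).
Proof.
case: e => //=; rewrite -[LHS](vert_const _ 1); congr vert.
apply/rowP => j; rewrite !mxE !inE -addrA; congr (_ + _).
by case: (_ \in _).
Qed.

(** Around a vertex, e_i and -e_i correspond to proper sets of sizes 1 and d, which differ as d >=
    2. So the image of one neighbour reveals sign and rotation. *)
Lemma vert_local_sign_inj e e' a (i j : 'I_d.+1) :
  vert (a + flip e (delta_mx 0 i)) = vert (a + flip e' (delta_mx 0 j)) ->
  e = e' /\ i = j.
Proof.
have pr e1 (l : 'I_d.+1) : local_sign e1 [set l]%SET != [set: 'I_d.+1]%SET.
  have [|_ //] := @proper_set_card (local_sign e1 [set l]%SET).
  by case: e1; rewrite /= ?cardsC1 ?cards1 ?card_ord /=; lia.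
rewrite -!ind1 !vert_flip_ind => /vert_ind_inj E; have {}E := E (pr _ _) (pr _ _).
have : #|local_sign e [set i]%SET| = #|local_sign e' [set j]%SET| by rewrite E.
case: e e' E => [] [] /= E; rewrite ?cardsC1 ?cards1 ?card_ord /=; try lia.
  by move: E => /(@finset.setC_inj _)/set1_inj.
by move: E => /set1_inj.
Qed.

Lemma induces_affine e m b f a : induces (affine e m (vec b)) f ->
  f (vert a) = vert (b + flip e (iter m int_rot a)).
Proof.
move=> fE; apply: (@vertex_eq _ _ (affine e m (vec b) (vec a))).
  exact/fE/mem_vert.
by rewrite /affine -vec_iter_rot -flip_vec -vecD addrC; apply: mem_vert.
Qed.

Lemma induces_affine_eq e m a b f g : rowlat k (a - b) ->
  induces (affine e m (vec a)) f -> induces (affine e m (vec b)) g -> f = g.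
Proof.
move=> ab fE gE; apply/funext => u; have [c ->] := vert_ex u.
rewrite (induces_affine _ fE) (induces_affine _ gE); apply/vert_eq.
by rewrite opprD addrACA subrr addr0.
Qed.

(** The group H of the theorem. *)
Definition stable_rotations : set (V R d -> V R d) :=
  [set h | exists2 m, stable m & h = iter m (@shift R d)].

Lemma stable_rotations_group : is_transf_group stable_rotations.
Proof.
split=> [|_ _ [m sm ->] [n sn ->]|_ [m sm ->]]; first by exists 0%N.
- exists (m + n)%N; last by apply/funext => x /=; rewrite iterD.
  by move=> x Lx; rewrite iterD; apply/sm/sn.
- exists (iter (m * d) (@shift R d)); split.
  + by exists (m * d)%N => //; apply: stable_inv.
  + exact: iter_shiftK.
  + exact: iter_shiftKV.
Qed.

Lemma stable_rotations_cyc : stable_rotations `<=` Ccyc R d.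
Proof.
move=> _ [m _ ->] G [[Gid Gcomp _] GS]; elim: m => [//|m IH].
by apply: (Gcomp (@shift R d) _ _ IH); apply: GS.
Qed.

Lemma stable_rotations_induce h : stable_rotations h ->
  exists f, AutT R k f /\ induces h f.
Proof.
move=> [m sm ->]; have [f fE] := induced_ex (compatible_shift sm).
exists f; split=> //; apply: (@affine_AutT false m 0) => //.
  by rewrite -(vec0 R d); apply: Lambda_vec.
by move=> u x /fE; rewrite /affine /= addr0.
Qed.

(** An affine map is a rotation, followed by a sign, followed by a translation, and each factor
    induces an automorphism. *)
Lemma AutT_generated : AutT R k =
  generated (Tgroup R k `|` Rgroup R k `|` induced_auts stable_rotations).
Proof.
apply/seteqP; split=> [f /AutT_affine[e [m [a [sm fE]]]] G [[Gid Gcomp _] GS]|f].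
  have La := Lambda_vec R a.
  have [t tE] := induced_ex (compatible_translation La).
  have [r rE] := induced_ex (compatible_flip e).
  have [h [hA hE]] := @stable_rotations_induce (iter m (@shift R d))
    (ex_intro2 _ _ (m : nat) sm erefl).
  have -> : f = t \o (r \o h).
    by apply: induces_uniq fE _; apply/(induces_comp tE)/(induces_comp rE).
  have L_0 : Lambda R d 0 by rewrite -(vec0 R d); apply: Lambda_vec.
  have s0 : stable 0 by [].
  apply: (Gcomp _ _ _ (Gcomp _ _ _ _)).
  - apply: GS; left; left; split; last first.
      by exists (fun x => x + vec a) => //; exists (vec a).
    exact: (@affine_AutT false 0 (vec a)).
  - case: e rE {fE} => rE.
      apply: GS; left; right; split; last by exists (fun x => - x).
      apply: (@affine_AutT true 0 0) => // u x /rE.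
      by rewrite /affine /= addr0.
    by rewrite (induces_uniq rE induces_id).
  - by apply: GS; right; split=> //; exists (iter m (@shift R d)) => //; exists m.
by apply; split; [apply: AutT_group|move=> g [[]|] []].
Qed.

Lemma card_range (I : finType) (T : Type) (F : I -> T) (A : set T) :
  injective F -> A = range F -> (A #= `I_#|I|)%card.
Proof.
move=> Finj ->.
have <- : (F \o @enum_val I predT) @` [set: 'I_#|I|] = range F.
  rewrite -image_comp; congr image; apply/seteqP; split=> // i _.
  by exists (enum_rank i) => //; apply: enum_rankK.
rewrite card_eq_sym; apply: card_eq_trans card_II _.
by rewrite card_eq_sym; apply: inj_card_eq => i j _ _ /Finj/enum_val_inj.
Qed.

Definition stable_ords : {set 'I_d.+1} := [set m : 'I_d.+1 | `[< stable m >]]%SET.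

Lemma card_stable_rotations : (stable_rotations #= `I_#|stable_ords|)%card.
Proof.
rewrite -card_sig.
apply: (@card_range _ _ (fun m : {m | m \in stable_ords} =>
  iter (sval m) (@shift R d))) => [m n E|].
  (* Exponents at most d are told apart by the image of the first unit vector. *)
  apply: val_inj; have := congr1 (fun h => h (vec (delta_mx 0 ord0))) E.
  rewrite /= -!vec_iter_rot !iter_rot_delta => e.
  have /vert_local_sign_inj[] // :
    vert (0 + flip false (delta_mx 0 (val m))) = vert (0 + flip false (delta_mx 0 (val n))).
  apply: (@vertex_eq _ _ (vec (0 + delta_mx 0 (val m)))); first exact: mem_vert.
  by rewrite vecD e -vecD; apply: mem_vert.
apply/seteqP; split=> [_ [m sm ->]|_ [[m ms] _ <-]]; last first.
  by exists m => //; move: ms; rewrite inE => /asboolP.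
have lt : (m %% d.+1 < d.+1)%N by rewrite ltn_mod.
have ms : Ordinal lt \in stable_ords.
  by rewrite inE; apply/asboolP => x; rewrite iter_shift_modn; apply: sm.
by exists (exist (fun n => n \in stable_ords) _ ms) => //; rewrite /= iter_shift_modn.
Qed.

Lemma det_gt0 : 0 < \det (M k).
Proof.
rewrite det_M ?(ltnW hd) // subr_gt0 ltz_nat.
have [i _] : exists i : 'I_d.+1, true by exists ord0.
rewrite (bigD1 i) //= [ltnRHS](bigD1 i) //=.
have le : (\prod_(j | j != i) k j <= \prod_(j | j != i) (k j).+1)%N.
  by apply: leq_prod => j _; apply: leqnSn.
apply: leq_ltn_trans (leq_mul (leqnn _) le) _.
by rewrite ltn_mul2r ltnSn andbT; apply: prodn_gt0.
Qed.

(** Automorphisms are indexed by triples: a representative of Z^(d+1) modulo the row lattice (det M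
    choices), a sign, and a stable exponent. *)
Lemma card_AutT : exists2 N : nat, (AutT R k #= `I_N)%card &
  N%:Z = 2 * #|stable_ords|%:Z * \det (M k).
Proof.
have [|X [dec [cX decI decS]]] := @lattice_transversal _ (M k).
  by rewrite gt_eqF ?det_gt0.
pose I := (X * bool * {m | m \in stable_ords})%type.
have stI (i : I) : stable (sval i.2).
  by case: i => ? [m /=]; rewrite inE => /asboolP.
have /choice[F FE] : forall i : I, exists f : Tvertex R k -> Tvertex R k,
    induces (affine i.1.2 (sval i.2) (vec (dec i.1.1))) f.
  move=> i; apply: induced_ex; apply: affine_compatible; first exact: stI.
  exact: Lambda_vec.
exists #|{: I}|; last first.
  rewrite !card_prod card_bool card_sig !PoszM cX gtr0_norm ?det_gt0 //.
  by rewrite -mulrA mulrC.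
apply: (@card_range _ _ F) => [i j E|].
  (* The image of 0 determines the translation; then the image of the first unit vector determines
     the sign and the exponent. *)
  have Fv a : F i (vert a) = F j (vert a) by rewrite E.
  have e0 m : iter m int_rot 0 = 0.
    by apply/rowP => l; rewrite iter_int_rot !mxE.
  have f0 e : flip e (0 : 'rV[int]_d.+1) = 0 by case: e; rewrite /= ?oppr0.
  have := Fv 0; rewrite !(induces_affine _ (FE _)) !e0 !f0 !addr0 => /vert_eq/decI x.
  have := Fv (delta_mx 0 ord0); rewrite !(induces_affine _ (FE _)) !iter_rot_delta x.
  move=> /vert_local_sign_inj[].
  case: i j x {E Fv} => [[x e] m] [[y e'] n] /= -> -> mn.
  by congr pair; apply: val_inj.
apply/seteqP; split=> [f /AutT_affine[e [m [a [sm fE]]]]|_ [i _ <-]]; last first.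
  by apply: affine_AutT (FE i) => //; apply: Lambda_vec.
have [x ax] := decS a.
have ms : m \in stable_ords by rewrite inE; apply/asboolP.
pose i : I := (x, e, exist (fun n => n \in stable_ords) m ms).
exists i => //.
exact/esym/(induces_affine_eq ax fE (FE i)).
Qed.

End Torus.

Local Open Scope card_scope.

Theorem theorem6p4 (R : realType) (d : nat) (k : 'I_d.+1 -> nat)
    (hd : (2 <= d)%N)
    (kpos : forall i, (0 < k i)%N)
    (kneq : exists i j, k i <> k j) :
  exists (H : set (V R d -> V R d)) (l N : nat),
    [/\ is_transf_group H /\ H `<=` Ccyc R d,
        H #= `I_l,
        forall h, H h -> exists f, AutT R k f /\ induces h f,
        AutT R k = generated (Tgroup R k `|` Rgroup R k `|` induced_auts H) &
        AutT R k #= `I_N /\ N%:Z = 2 * l%:Z * \det (M k)].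
Proof.
have [N cN NE] := card_AutT R hd kpos.
exists (@stable_rotations R d k), #|stable_ords R k|, N; split=> //.
- by split; [apply: stable_rotations_group|apply: stable_rotations_cyc].
- exact: card_stable_rotations.
- exact: stable_rotations_induce.
- exact: AutT_generated.
Qed.
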